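(* Let $T\in(0,\infty)$, and let $A:U_T\to\mathcal M^{n\times n}_{\rm sym}$, $K:U_T\to\mathcal M^{n\times n}$, $B:U_T\times J\to\mathbb R^n$ and $b:U_T\to\mathbb R^n$ be given functions. Assume there exists a constant $c_0>0$ such that $\xi^{\rm T}A(x,t)\xi\ge c_0|\xi|^2$ for all $(x,t)\in U_T$ and all $\xi\in\mathbb R^n$. Let $u\in C(\overline{U_T})\cap C^{2,1}_{x,t}(U_T)$ and define, for $t\in(0,T]$, $$G_1(t)=\max_{\Gamma_t}u,\qquad G_2(t)=\min_{\Gamma_t}u,\qquad G(t)=\max_{\Gamma_t}|u|.$$ Consider the operator $\mathscr L$ to be either (a) $\mathscr L=\widetilde L$, or (b) $\mathscr L=L$ with $u(U_T)\subset J$. Then the following statements hold true. (i) Suppose there is a function $F_1\in C([0,T],[0,\infty))$ such that $\mathscr Lu(x,t)\le F_1(t)$ for all $(x,t)\in U_T$. Then $$\max_{\overline{U_t}}u\le G_1(t)+\int_0^tF_1(\tau)\,{\rm d}\tau\quad\text{for all }t\in(0,T].$$ (ii) Suppose there is a function $F_2\in C([0,T],[0,\infty))$ such that $\mathscr Lu(x,t)\ge-F_2(t)$ for all $(x,t)\in U_T$. Then $$\min_{\overline{U_t}}u\ge G_2(t)-\int_0^tF_2(\tau)\,{\rm d}\tau\quad\text{for all }t\in(0,T].$$ (iii) Suppose there is a function $F\in C([0,T],[0,\infty))$ such that $|\mathscr Lu(x,t)|\le F(t)$ for all $(x,t)\in U_T$. Then $$\max_{\overline{U_t}}|u|\le G(t)+\int_0^tF(\tau)\,{\rm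 d}\tau\quad\text{for all }t\in(0,T].$$
   Context: $n\ge1$ is fixed; $U$ is a non-empty, open, bounded subset of $\mathbb R^n$ with boundary $\Gamma$ and closure $\bar U$. For $t\in(0,\infty)$: $U_t=U\times(0,t]$, $\overline{U_t}=\bar U\times[0,t]$, and the parabolic boundary is $\Gamma_t=\overline{U_t}\setminus U_t$. $\mathcal M^{n\times n}$ (resp. $\mathcal M^{n\times n}_{\rm sym}$) is the set of real (resp. real symmetric) $n\times n$ matrices. $C^{2,1}_{x,t}(U\times I)$, for an interval $I$, is the class of continuous functions on $U\times I$ with continuous partial derivatives $\partial u/\partial t$, $\partial u/\partial x_i$, $\partial^2u/\partial x_i\partial x_j$. $\langle A,B\rangle={\rm Tr}(A^{\rm T}B)$; $D^2u$, $\nabla u$ are the Hessian and gradient in $x$. $J$ is an interval in $\mathbb R$ with non-empty interior and $P\in C^1(J,\mathbb R)$ with $P'\in C(J,[0,\infty))$. The operators are $$\widetilde Lw=w_t-\langle A(x,t),D^2w\rangle+b(x,t)\cdot\nabla w,$$ $$Lu=\frac{\partial u}{\partial t}-\langle A(x,t),D^2u\rangle+B(x,t,u)\cdot\nabla u+P'(u)(K(x,t)\nabla u)\cdot\nabla u.$$ *)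

(* Defs.v *)
From HB Require Import structures.
From mathcomp Require Export all_boot all_order all_algebra.
From mathcomp Require Export all_classical all_reals all_analysis.
Export Order.TTheory GRing.Theory Num.Theory numFieldNormedType.Exports.

Set Implicit Arguments.
Unset Strict Implicit.
Unset Printing Implicit Defensive.

Local Open Scope classical_set_scope.
Local Open Scope ring_scope.

(* Functions given on a set [D] are total functions of which only the values
   on [D] are ever used; in particular the topology and the difference
   quotients below are those relative to [D]. *)

Section Extrema.
Context {R : realType} {X : Type}.
Implicit Types (f : X -> R) (D : set X) (m : R).

Definition is_max f D m := (f @` D) m /\ forall x, D x -> f x <= m.
Definition is_min f D m := (f @` D) m /\ forall x, D x -> m <= f x.

(* The value is 0 when the extremum is not attained; [max_onP] and [min_onP]
   cover nonempty compact [D] and continuous [f]. *)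
Definition max_on f D : R := xget 0 [set m | is_max f D m].
Definition min_on f D : R := xget 0 [set m | is_min f D m].

End Extrema.

Lemma max_onP {R : realType} {X : topologicalType} (f : X -> R) (D : set X) :
  D !=set0 -> compact D -> {within D, continuous f} ->
  is_max f D (max_on f D).
Proof.
move=> D0 cD cf; have [c /set_mem Dc cmax] := compact_EVT_max D0 cD cf.
apply: (@xgetPex _ 0 [set m | is_max f D m]); exists (f c); split; first exact: imageP.
by move=> x Dx; apply: cmax; exact/mem_set.
Qed.

Lemma min_onP {R : realType} {X : topologicalType} (f : X -> R) (D : set X) :
  D !=set0 -> compact D -> {within D, continuous f} ->
  is_min f D (min_on f D).
Proof.
move=> D0 cD cf; have [c /set_mem Dc cmin] := compact_EVT_min D0 cD cf.
apply: (@xgetPex _ 0 [set m | is_min f D m]); exists (f c); split; first exact: imageP.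
by move=> x Dx; apply: cmin; exact/mem_set.
Qed.

Section DerivativeWithin.
Context {R : realType}.
Implicit Types (D : set R) (f : R -> R) (x : R).

(* The increment [h] is restricted to [h + x \in D], which makes the derivative
   one-sided at an endpoint of an interval [D]. *)
Definition within_quotient D f x : set_system R :=
  (fun h : R => h^-1 * (f (h + x) - f x))
    @ within [set h : R | D (h + x)] (0 : R)^'.

Definition derivable_within D f x : Prop := cvg (within_quotient D f x).

Definition deriv_within D f x : R := lim (within_quotient D f x).

Lemma deriv_within_nbhs D f x : nbhs x D -> deriv_within D f x = derive1 f x.
Proof.
move=> xD; rewrite /deriv_within /within_quotient /derive1; congr (lim _).
have near0 : \forall h \near (0 : R)^', D (h + x).
  apply: nbhs_dnbhs; have : (fun h : R => h + x) @ (0 : R) --> x.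
    by rewrite -[X in _ --> X]add0r; apply: cvgD; [exact: cvg_id|exact: cvg_cst].
  exact.
suff -> : within [set h | D (h + x)] (0 : R)^' = (0 : R)^' by [].
rewrite predeqE => A; rewrite /within /=; split=> H; near=> h.
  by apply: (near H h) => //; near: h; exact: near0.
by move=> _; near: h.
Unshelve. all: by end_near. Qed.

Definition C1_on D f : Prop :=
  (forall x, D x -> derivable_within D f x) /\
  {within D, continuous (deriv_within D f)}.

End DerivativeWithin.

Section Parabolic.
Context {R : realType} {n : nat}.
Local Notation V := 'rV[R]_n.
Implicit Types (U : set V) (I J : set R) (z : V * R) (u w : V * R -> R).

Definition cylinder U (t : R) : set (V * R) := U `*` `]0, t].
Definition closed_cylinder U (t : R) : set (V * R) := closure U `*` `[0, t].
Definition parabolic_boundary U (t : R) : set (V * R) :=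
  closed_cylinder U t `\` cylinder U t.

Definition dt I u z : R := deriv_within I (fun s => u (z.1, s)) z.2.
Definition dx (i : 'I_n) u z : R := 'D_(delta_mx 0 i) (fun y => u (y, z.2)) z.1.

Definition derivable_dt I u z : Prop :=
  derivable_within I (fun s => u (z.1, s)) z.2.
Definition derivable_dx (i : 'I_n) u z : Prop :=
  derivable (fun y => u (y, z.2)) z.1 (delta_mx 0 i).

Definition C21 U I u : Prop :=
  [/\ {within U `*` I, continuous u},
      (forall z, (U `*` I) z -> derivable_dt I u z) /\
        {within U `*` I, continuous (dt I u)},
      forall i : 'I_n,
        (forall z, (U `*` I) z -> derivable_dx i u z) /\
        {within U `*` I, continuous (dx i u)} &
      forall i j : 'I_n,
        (forall z, (U `*` I) z -> derivable_dx i (dx j u) z) /\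
        {within U `*` I, continuous (dx i (dx j u))}].

Definition grad u z : V := \row_i dx i u z.
Definition hess u z : 'M[R]_n := \matrix_(i, j) dx i (dx j u) z.

(* The library norm on ['rV[R]_n] is the sup norm, so |v|^2 is [dotv v v]. *)
Definition dotv (v w : V) : R := \sum_i v 0 i * w 0 i.
Definition mulmv (M : 'M[R]_n) (v : V) : V := (M *m v^T)^T.
Definition inner_mx (A B : 'M[R]_n) : R := \tr (A^T *m B).

Definition Ltilde I (A : V * R -> 'M[R]_n) (b : V * R -> V) w z : R :=
  dt I w z - inner_mx (A z) (hess w z) + dotv (b z) (grad w z).

Definition Lop I J (A K : V * R -> 'M[R]_n) (B : V * R -> R -> V) (P : R -> R)
    u z : R :=
  dt I u z - inner_mx (A z) (hess u z) + dotv (B z (u z)) (grad u z)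
  + deriv_within J P (u z) * dotv (mulmv (K z) (grad u z)) (grad u z).

End Parabolic.

(* Main.v *)
(* For e > 0 the function w(x, s) = u(x, s) - int_0^s F - e s attains its maximum
   over the closed cylinder on the parabolic boundary: at a maximum inside, the
   gradient of u vanishes, so that both operators reduce to u_t - <A, D^2 u>,
   the Hessian is negative semidefinite, whence <A, D^2 u> <= 0, and the left
   difference quotients in time give u_t >= F + e, a contradiction. Since at
   such points the reduced operator is linear in u, lower bounds follow by
   applying this to -u. *)
Require Import Defs.
From mathcomp Require Import ring lra.

Set Implicit Arguments.
Unset Strict Implicit.
Unset Printing Implicit Defensive.

Local Open Scope classical_set_scope.
Local Open Scope ring_scope.

(** * Directional derivatives from continuous partial derivatives *)

Section DirectionalDerivative.
Context {R : realType}.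

Lemma is_derive_line (V : normedModType R) (f : V -> R) (x v : V) (s d : R) :
  is_derive (x + s *: v) v f d -> is_derive s 1 (fun r => f (x + r *: v)) d.
Proof.
have E : (fun h : R => h^-1 *:
      (((fun r => f (x + r *: v)) \o shift s) (h *: 1) - f (x + s *: v)))
    = (fun h => h^-1 *: ((f \o shift (x + s *: v)) (h *: v) - f (x + s *: v))).
  by apply/funext => h /=; rewrite [_%:A]mulr1 scalerDl addrCA.
by move=> [df dE]; split; [rewrite /derivable E|rewrite /derive E].
Qed.

(** The mean value theorem between [0] and [c] writes the left-hand side as [(dg r - d) * c] up to
    the absolute value. Both signs of [c] are treated, because [c] will be a coordinate of an
    arbitrary increment. *)
Lemma mean_value_expansion (g dg : R -> R) (c d e : R) :
  (forall r : R, `|r| <= `|c| -> is_derive r 1 g (dg r)) ->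
  (forall r, `|r| <= `|c| -> `|dg r - d| <= e) ->
  `|g c - g 0 - c * d| <= e * `|c|.
Proof.
move=> gd dge.
have cont a b : (forall r, r \in `[a, b]%R -> `|r| <= `|c|) ->
    {within `[a, b], continuous g}.
  move=> ab; apply: derivable_within_continuous => r rab.
  by have [] := gd _ (ab _ rab).
have [c0|/ltW c0] := leP 0 c.
- have sub r : r \in `[0, c]%R -> `|r| <= `|c|.
    by rewrite in_itv/= => /andP[r0 rc]; rewrite !ger0_norm.
  have [] := @MVT_segment R g dg 0 c c0 _ (cont _ _ sub).
    by move=> r /subset_itv_oo_cc /sub; exact: gd.
  move=> r /sub rc ->; rewrite subr0 (_ : _ - _ = (dg r - d) * c); last by ring.
  by rewrite normrM ler_wpM2r// dge.
- have sub r : r \in `[c, 0]%R -> `|r| <= `|c|.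
    by rewrite in_itv/= => /andP[r0 rc]; rewrite !ler0_norm// lerN2.
  have [] := @MVT_segment R g dg c 0 c0 _ (cont _ _ sub).
    by move=> r /subset_itv_oo_cc /sub; exact: gd.
  move=> r /sub rc E.
  rewrite (_ : _ - _ = (dg r - d) * c); last by lra.
  by rewrite normrM ler_wpM2r// dge.
Qed.

(** The path from [x] to [x + w] changes one coordinate at a time, and each leg is estimated by
    [mean_value_expansion]. All legs stay in the box of the hypothesis, and the errors add up. *)
Lemma partial_expansion n (f : 'rV[R]_n -> R) (p : 'I_n -> 'rV[R]_n -> R)
    (x w : 'rV[R]_n) (e : R) :
  (forall y : 'rV[R]_n, (forall i, `|y 0 i - x 0 i| <= `|w 0 i|) -> forall i,
     is_derive y (delta_mx 0 i) f (p i y) /\ `|p i y - p i x| <= e) ->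
  `|f (x + w) - f x - \sum_i w 0 i * p i x| <= e * \sum_i `|w 0 i|.
Proof.
move=> H.
(* [ws s] keeps the coordinates of [w] listed in [s] and sets the others to 0; the induction on [s]
   switches them on one by one. *)
pose ws (s : seq 'I_n) : 'rV[R]_n := \row_j (if j \in s then w 0 j else 0).
suff main s : uniq s -> `|f (x + ws s) - f x - \sum_(i <- s) w 0 i * p i x|
    <= e * \sum_(i <- s) `|w 0 i|.
  have := main (index_enum 'I_n) (index_enum_uniq _).
  rewrite (_ : ws _ = w)//.
  by apply/rowP => j; rewrite mxE mem_index_enum.
elim: s => [_|i s IH /=/andP[ins us]].
  rewrite !big_nil (_ : ws _ = 0) ?addr0 ?subrr ?subr0 ?normr0 ?mulr0//.
  by apply/rowP => j; rewrite !mxE.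
rewrite !big_cons mulrDr.
have wsE : x + ws (i :: s) = x + ws s + w 0 i *: delta_mx 0 i.
  rewrite -addrA; congr (_ + _); apply/rowP => j; rewrite !mxE inE eqxx/=.
  have [->|] := eqVneq j i; first by rewrite (negbTE ins) add0r mulr1.
  by rewrite mulr0 addr0.
have near r : `|r| <= `|w 0 i| -> forall j,
    `|(x + ws s + r *: delta_mx 0 i) 0 j - x 0 j| <= `|w 0 j|.
  move=> rw j; rewrite !mxE eqxx/=; have [->|_] := eqVneq j i.
    by rewrite (negbTE ins) addr0 mulr1 addrC addKr.
  by rewrite mulr0 addr0 addrC addKr; case: ifP; rewrite ?normr0.
have := @mean_value_expansion (fun r => f (x + ws s + r *: delta_mx 0 i))
  (fun r => p i (x + ws s + r *: delta_mx 0 i)) (w 0 i) (p i x) e.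
rewrite -wsE scale0r addr0 => step.
have := lerD (step _ _) (IH us); set a := f _; set b := f _; set c := f _.
set S := \sum_(j <- s) _.
move=> K; apply: le_trans (K _ _).
- rewrite (_ : a - c - _ = (a - b - w 0 i * p i x) + (b - c - S)); last by ring.
  exact: ler_normD.
- by move=> r /near/H/(_ i)[+ _]; exact: is_derive_line.
- by move=> r /near/H/(_ i)[].
Qed.
(** Near [x] the partial derivatives differ little from their values at [x], so [partial_expansion]
    with [w = h *: v] leaves an error of small order compared with [h]. *)
Lemma is_derive_partials n (f : 'rV[R]_n -> R) (p : 'I_n -> 'rV[R]_n -> R)
    (x v : 'rV[R]_n) :
  (\forall y \near x, forall i, is_derive y (delta_mx 0 i) f (p i y)) ->
  (forall i, {for x, continuous (p i)}) ->
  is_derive x v f (\sum_i v 0 i * p i x).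
Proof.
move=> fp pc.
suff H : h^-1 *: ((f \o shift x) (h *: v) - f x) @[h --> 0^'] -->
    \sum_i v 0 i * p i x.
  by split; [apply/cvg_ex; eexists; exact: H|exact: (cvg_lim _ H)].
apply/cvgrPdist_le => e e0.
(* The tolerance [e / (C + 1)] turns the final error into [e * C / (C + 1)], at most [e]; adding 1
   avoids a division by 0 when [v = 0]. *)
set C := \sum_i `|v 0 i|; have C0 : 0 <= C by apply: sumr_ge0.
have C1 : 0 < C + 1 by lra.
have pe : \forall y \near x, forall i,
    is_derive y (delta_mx 0 i) f (p i y) /\ `|p i y - p i x| <= e / (C + 1).
  near=> y => i; split; first by move: i; near: y.
  move: i; near: y; apply: filter_forall => i.
  move: (pc i) => /cvgrPdist_le/(_ (e / (C + 1)) (divr_gt0 e0 C1)).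
  by apply: filterS => y; rewrite distrC.
have /nbhs_ballP[d /= d0 xd] := pe.
near=> h.
have h0 : h != 0 by near: h; exact: nbhs_dnbhs_neq.
(* Each [|v 0 j|] is at most [C], so the whole box of [partial_expansion] around [x] lies in the
   ball of radius [d]. *)
have hd : `|h| < d / (C + 1).
  by near: h; apply: dnbhs0_lt; exact: divr_gt0.
have step : `|f (x + h *: v) - f x - \sum_i (h *: v) 0 i * p i x|
    <= e / (C + 1) * \sum_i `|(h *: v) 0 i|.
  apply: partial_expansion => y yx; apply: xd; split=> // i j.
  rewrite ord1 /ball/= distrC (le_lt_trans (yx j))// mxE normrM.
  have : `|v 0 j| <= C by rewrite /C (bigD1 j)//= lerDl sumr_ge0.
  move=> vC; apply: (@le_lt_trans _ _ (`|h| * (C + 1))).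
    by rewrite ler_wpM2l//; lra.
  by rewrite -ltr_pdivlMr.
have -> : \sum_i v 0 i * p i x - h^-1 *: ((f \o shift x) (h *: v) - f x)
   = - (h^-1 * (f (x + h *: v) - f x - \sum_i (h *: v) 0 i * p i x)).
  have -> : \sum_i (h *: v) 0 i * p i x = h * \sum_i v 0 i * p i x.
    by rewrite mulr_sumr; apply: eq_bigr => i _; rewrite mxE mulrA.
  rewrite /= (addrC (h *: v)) -[_ *: _]/(_ * _); move: (\sum_i _) (f _) (f _) => *.
  by field.
rewrite normrN normrM normfV ler_pdivrMl ?normr_gt0//.
apply: le_trans step _.
have -> : \sum_i `|(h *: v) 0 i| = `|h| * C.
  by rewrite mulr_sumr; apply: eq_bigr => i _; rewrite mxE normrM.
rewrite mulrCA ler_wpM2l// mulrAC ler_pdivrMr// ler_wpM2l//; last by lra.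
exact: ltW.
Unshelve. all: by end_near. Qed.

End DirectionalDerivative.

(** * First and second order conditions at an interior maximum in space *)

Section SecondOrder.
Context {R : realType}.

(** If [m] were positive, [g' h / h] would be positive for small nonzero [h], so [g'] would be
    positive just to the right of 0; the mean value theorem then gives a value of [g] above
    [g 0]. *)
Lemma second_derivative_test (g g' : R -> R) (m : R) :
  (\forall s \near (0 : R), is_derive (s : R) 1 g (g' s)) ->
  is_derive (0 : R) 1 g' m ->
  (\forall s \near (0 : R), g s <= g 0) -> g' 0 = 0 /\ m <= 0.
Proof.
move=> gd g'd gmax.
have /nbhs_ballP[d /= d0 dP] :
    \forall s \near (0 : R), is_derive (s : R) 1 g (g' s) /\ g s <= g 0.
  by near=> s; split; near: s.
have inb (s : R) : s \in `](- d), d[%R -> is_derive s 1 g (g' s) /\ g s <= g 0.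
  rewrite in_itv/= => /andP[ds sd]; apply: dP.
  by rewrite /ball/= sub0r normrN ltr_norml ds.
have zin : 0 \in `](- d), d[%R by rewrite in_itv/= oppr_lt0 d0.
have g'0 : g' 0 = 0.
  have [] := @derive1_at_max R g (- d) d 0 _ _ zin _; first by lra.
  - by move=> t /inb[[]].
  - by move=> t /inb[].
  by move=> _ D0; have [[_ <-] _] := inb _ zin.
split=> //; rewrite leNgt; apply/negP => m0.
have [dg' dE] := g'd.
have H : h^-1 *: ((g' \o shift 0) (h *: 1) - g' 0) @[h --> 0^'] --> m.
  by rewrite -dE; exact: dg'.
have pos : \forall h \near (0 : R)^', 0 < h^-1 * g' h.
  have Hgt := cvgr_gt _ H _ m0; near=> h.
  suff : 0 < h^-1 *: ((g' \o shift 0) (h *: 1) - g' 0).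
    by rewrite /= addr0 [_%:A]mulr1 g'0 subr0.
  by near: h; exact: Hgt.
have /nbhs_ballP[r /= r0 rP] :
  \forall h \near (0 : R), h != 0 -> 0 < h^-1 * g' h by exact: pos.
(* The halves keep [c] strictly within both radii: [d] for differentiability and maximality, [r] for
   the sign of [g']. *)
pose c := Num.min (d / 2) (r / 2).
have c0 : 0 < c by rewrite lt_min !divr_gt0.
have cd : c < d by rewrite gt_min; apply/orP; left; lra.
have cr : c < r by rewrite gt_min; apply/orP; right; lra.
have sub s : s \in `[0, c]%R -> s \in `](- d), d[%R.
  by rewrite !in_itv/= => /andP[s0 sc]; apply/andP; split; lra.
have [t tin E] : exists2 t, t \in `]0, c[%R & g c - g 0 = g' t * (c - 0).
  apply: (MVT c0) => [s /subset_itv_oo_cc/sub/inb[]//|].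
  by apply: derivable_within_continuous => s /sub/inb[[]].
have [_ gc] : is_derive c 1 g (g' c) /\ g c <= g 0.
  by apply/inb/sub; rewrite in_itv/= lexx ltW.
move: tin; rewrite in_itv/= => /andP[t0 tc].
have := rP t; rewrite /ball/= sub0r normrN gtr0_norm// gt_eqF//.
move=> /(_ (lt_trans tc cr) isT); rewrite pmulr_rgt0 ?invr_gt0// => g't.
have := mulr_gt0 g't c0; lra.
Unshelve. all: by end_near. Qed.

(** Along the line [x + s *: v], applying [is_derive_partials] to [f] and then to each [p i]
    identifies the two sums as first and second derivatives in [s], and the one-variable test
    applies. *)
Lemma interior_max_second_order n (U : set 'rV[R]_n) (f : 'rV[R]_n -> R)
    (p : 'I_n -> 'rV[R]_n -> R) (q : 'I_n -> 'I_n -> 'rV[R]_n -> R)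
    (x : 'rV[R]_n) :
  open U ->
  (forall y, U y -> forall i, is_derive y (delta_mx 0 i) f (p i y)) ->
  (forall y, U y -> forall i, {for y, continuous (p i)}) ->
  (forall y, U y -> forall i j, is_derive y (delta_mx 0 i) (p j) (q i j y)) ->
  (forall i j, {for x, continuous (q i j)}) ->
  U x -> (forall y, U y -> f y <= f x) ->
  (forall i, p i x = 0) /\
  (forall v : 'rV[R]_n, \sum_i v 0 i * \sum_j v 0 j * q j i x <= 0).
Proof.
move=> oU fp pc pq qc Ux fmax.
have nU : \forall y \near x, U y by exact: open_nbhs_nbhs.
have main (v : 'rV[R]_n) : \sum_i v 0 i * p i x = 0 /\
    \sum_i v 0 i * \sum_j v 0 j * q j i x <= 0.
  have seg : \forall s \near (0 : R), U (x + s *: v).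
    have : (fun s : R => x + s *: v) @ 0 --> x.
      rewrite -[X in _ --> X](_ : x + (0 : R) *: v = x); last first.
        by rewrite scale0r addr0.
      by apply: cvgD; [exact: cvg_cst|exact: cvgZr_tmp].
    exact.
  have fv y : U y -> is_derive y v f (\sum_i v 0 i * p i y).
    move=> Uy; apply: is_derive_partials; last exact: pc.
    have : \forall z \near y, U z by exact: open_nbhs_nbhs.
    by apply: filterS => z Uz i; exact: fp.
  have pv : is_derive x v (fun y => \sum_i v 0 i * p i y)
      (\sum_i v 0 i * \sum_j v 0 j * q j i x).
    have H i : is_derive x v (p i) (\sum_j v 0 j * q j i x).
      apply: (is_derive_partials (p := fun j => q j i)) => //.
      by apply: filterS nU => z Uz j; exact: pq.
    have -> : (fun y => \sum_i v 0 i * p i y) = \sum_i (v 0 i *: p i).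
      by apply/funext => y; rewrite fct_sumE.
    apply: is_derive_sum => i; exact: is_deriveZ.
  have x0 : x + (0 : R) *: v = x by rewrite scale0r addr0.
  have := @second_derivative_test (fun s => f (x + s *: v))
    (fun s => \sum_i v 0 i * p i (x + s *: v))
    (\sum_i v 0 i * \sum_j v 0 j * q j i x).
  rewrite x0; apply.
  - by apply: filterS seg => s Us; apply: is_derive_line; exact: fv.
  - apply: (is_derive_line (f := fun y => \sum_i v 0 i * p i y)).
    by rewrite x0.
  - by apply: filterS seg => s Us; exact: fmax.
split=> [i|v]; last by have [] := main v.
have [+ _] := main (delta_mx 0 i).
rewrite (bigD1 i)//= big1 ?addr0; first by rewrite mxE !eqxx mul1r.
by move=> j ji; rewrite mxE eqxx (negbTE ji) mul0r.
Qed.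

End SecondOrder.

(** * The trace inequality for positive definite and negative semidefinite matrices *)

(* Peeling off the rank one matrix built on the first row of [A] leaves a Schur
   complement, which is again positive definite. *)
Lemma mxtrace_posdef_negsemidef (R : realFieldType) n (A H : 'M[R]_n) :
  A^T = A ->
  (forall v : 'rV_n, v != 0 -> 0 < (v *m A *m v^T) 0 0) ->
  (forall v : 'rV_n, (v *m H *m v^T) 0 0 <= 0) ->
  \tr (A *m H) <= 0.
Proof.
elim: n A H => [|n IH]; first by move=> A H *; rewrite /mxtrace big_ord0.
rewrite -[n.+1]/(1 + n)%N => A H As Ap Hn.
pose a := A 0 0.
pose r : 'rV_n := ursubmx (A : 'M[R]_(1 + n, 1 + n)).
pose D : 'M[R]_n := drsubmx (A : 'M[R]_(1 + n, 1 + n)).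
have AE : A = block_mx a%:M r r^T D :> 'M[R]_(1 + n, 1 + n).
  rewrite -[LHS](@submxK _ 1 n 1 n); congr block_mx.
    by apply/matrixP => i j; rewrite !ord1 !mxE/= mulr1n; congr (A _ _); exact/val_inj.
  by rewrite /r trmx_ursub As.
have a0 : 0 < a.
  have /Ap : delta_mx 0 0 != 0 :> 'rV[R]_n.+1.
    by apply/eqP => /rowP/(_ 0)/eqP; rewrite !mxE oner_eq0.
  by rewrite -rowE trmx_delta -colE !mxE.
pose D' := D - a^-1 *: (r^T *m r).
pose c : 'rV[R]_(1 + n) := row_mx a%:M r.
have Adec : A = a^-1 *: (c^T *m c) + block_mx 0 0 0 D' :> 'M[R]_(1 + n, 1 + n).
  rewrite AE /c tr_row_mx mul_col_row scale_block_mx add_block_mx !addr0.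
  rewrite tr_scalar_mx -scalar_mxM scale_scalar_mx mul_scalar_mx mul_mx_scalar.
  rewrite !scalerA !mulKf ?mulVf ?gt_eqF// !scale1r.
  by congr block_mx; rewrite /D' addrC subrK.
have D's : D'^T = D'.
  rewrite /D' linearB linearZ /= trmx_mul trmxK; congr (_ - _).
  by rewrite /D trmx_drsub As.
have D'p (v : 'rV_n) : v != 0 -> 0 < (v *m D' *m v^T) 0 0.
  (* The first coordinate is chosen so that [w *m c^T = 0]: the rank one term drops out, and the
     form of [A] at [w] is that of [D'] at [v]. *)
  move=> v0; pose w : 'rV[R]_(1 + n) := row_mx (- a^-1 *: (r *m v^T)^T) v.
  have /Ap : w != 0 :> 'rV_n.+1.
    apply: contra v0 => /eqP w0; apply/eqP; rewrite -(row_mxKr (- a^-1 *: (r *m v^T)^T) v).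
    by rewrite -/w w0 linear0.
  have wc : w *m c^T = 0.
    rewrite /w /c tr_row_mx mul_row_col tr_scalar_mx mul_mx_scalar scalerA.
    by rewrite mulrN divff ?gt_eqF// scaleN1r trmx_mul trmxK addNr.
  rewrite {1}Adec mulmxDr -scalemxAr mulmxA wc mul0mx scaler0 add0r.
  by rewrite /w mul_row_block !mulmx0 !addr0 add0r tr_row_mx mul_row_col mul0mx add0r.
(* By cyclicity of the trace the rank one term contributes [a^-1] times the value of the form of [H]
   at [c]. *)
rewrite Adec mulmxDl -scalemxAl mxtraceD mxtraceZ -mulmxA mxtrace_mulC.
have /= cH : \tr (c *m H *m c^T) <= 0.
  by rewrite /mxtrace big_ord1; exact: Hn.
(* Only the lower right block of [H] meets [D'] in the trace; its form is that of [H] on the vectors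
   [row_mx 0 v], so the induction hypothesis applies. *)
have trD : \tr (block_mx 0 0 0 D' *m H : 'M[R]_(1 + n, 1 + n)) <= 0.
  rewrite -[H](@submxK _ 1 n 1 n) mulmx_block !mul0mx !add0r mxtrace_block.
  rewrite linear0 add0r; apply: IH => // v.
  have := Hn (row_mx 0 v : 'rV[R]_(1 + n)).
  rewrite -[H](@submxK _ 1 n 1 n) mul_row_block !mul0mx !add0r.
  by rewrite tr_row_mx mul_row_col trmx0 mulmx0 add0r block_mxKdr.
by rewrite -[leRHS]addr0 lerD// pmulr_rle0 ?invr_gt0.
Qed.

(** * Compactness of the closed cylinder and of the parabolic boundary *)

Section Topology.
Context {R : realType} {n : nat}.
Implicit Types (U : set 'rV[R]_n) (t : R).

Lemma bounded_closure U : bounded_set U -> bounded_set (closure U).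
Proof.
move=> [M [Mreal UM]]; exists (M + 1); split; first exact: num_real.
move=> x Mx v Uv /=.
have [y [Uy]] := Uv _ (nbhsx_ballx v 1 ltr01).
rewrite -ball_normE /= => vy.
have yx : `|y| <= x - 1 by apply: (UM (x - 1)) => //; lra.
rewrite -(subrK y v) (le_trans (ler_normD _ _))//; lra.
Qed.

Lemma compact_closed_cylinder U t : bounded_set U -> compact (closed_cylinder U t).
Proof.
move=> bU; apply: compact_setX; last exact: segment_compact.
apply: bounded_closed_compact; first exact: bounded_closure.
exact: closed_closure.
Qed.

Lemma open_cylinder_unbounded U : open U -> open (U `*` [set s : R | 0 < s]).
Proof.
move=> oU.
rewrite (_ : _ `*` _ = fst @^-1` U `&` snd @^-1` [set s : R | 0 < s]); last first.
  by apply/seteqP; split.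
apply: openI; apply: open_comp => //.
- by move=> z _; exact: cvg_fst.
- by move=> z _; exact: cvg_snd.
Qed.

(** Times in the closed cylinder are at most [t], so the cylinder can be removed together with all
    its later times. What is removed is then open when [U] is, and the rest is closed in a compact
    set. *)
Lemma parabolic_boundaryE U t :
  parabolic_boundary U t =
  closed_cylinder U t `&` ~` (U `*` [set s : R | 0 < s]).
Proof.
apply/seteqP; split=> -[x s] [[/= Ux]]; rewrite /= in_itv/= => /andP[s0 st];
  move=> H; split=> //=; try (by split=> //=; rewrite in_itv/= s0).
- by move=> [/= Ux' s0']; apply: H; split=> //=; rewrite in_itv/= s0'.
- by move=> [/= Ux']; rewrite in_itv/= => /andP[s0' _]; apply: H.
Qed.

Lemma compact_parabolic_boundary U t :
  open U -> bounded_set U -> compact (parabolic_boundary U t).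
Proof.
move=> oU bU; rewrite parabolic_boundaryE; apply: compact_closedI.
  exact: compact_closed_cylinder.
by apply: open_closedC; exact: open_cylinder_unbounded.
Qed.

Lemma parabolic_boundary_neq0 U t :
  0 <= t -> U !=set0 -> parabolic_boundary U t !=set0.
Proof.
move=> t0 [x Ux]; exists (x, 0); split.
  by split; [exact: subset_closure|rewrite /= in_itv/= lexx].
by move=> [_ /=]; rewrite in_itv/= ltxx.
Qed.

Lemma closed_cylinder_sub U t T : t <= T ->
  closed_cylinder U t `<=` closed_cylinder U T.
Proof.
move=> tT [x s] [/= Ux]; rewrite in_itv/= => /andP[s0 st]; split=> //=.
by rewrite in_itv/= s0 (le_trans st).
Qed.

End Topology.

(** * The primitive of the bound in time *)

(** These are the properties of the integral that the comparison function uses. The derivative is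
    taken from the left only, so that [s = T] is included. *)
Lemma primitive_on_segment (R : realType) (F : R -> R) (T : R) :
  0 < T -> {within `[0, T], continuous F} ->
  (forall t, 0 <= t <= T -> 0 <= F t) ->
  let Phi := fun t => \int[lebesgue_measure]_(s in `[0, t]) F s in
  [/\ {within `[0, T], continuous Phi},
      forall t, 0 <= t <= T -> 0 <= Phi t,
      forall s t, 0 <= s -> s <= t -> t <= T -> Phi s <= Phi t &
      forall s, 0 < s <= T ->
        h^-1 * (Phi (h + s) - Phi s) @[h --> 0^'-] --> F s].
Proof.
move=> T0 cF F0 Phi.
have intF t : t <= T -> lebesgue_measure.-integrable `[0, t] (EFin \o F).
  move=> tT; apply: continuous_compact_integrable; first exact: segment_compact.
  by apply: continuous_subspaceW cF; apply: subset_itvl; rewrite bnd_simp.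
split.
- by apply: parameterized_integral_continuous; [exact: ltW|exact: intF].
- move=> t /andP[t0 tT]; apply: Rintegral_ge0 => s /=.
  by rewrite in_itv/= => /andP[s0 st]; rewrite F0// s0 (le_trans st).
- move=> s t s0 st tT; rewrite -subr_ge0 Rintegral_itvB ?bnd_simp//; last exact: intF.
  apply: Rintegral_ge0 => r /=; rewrite in_itv/= => /andP[sr rt].
  by rewrite F0// (le_trans s0 (ltW sr)) (le_trans rt).
move=> s /andP[s0 sT].
(* [F] is extended to a continuous function beyond [T], so that the derivative
   of its primitive is two-sided at [T] as well. *)
pose cl r := Num.max 0 (Num.min T r).
have clin r : `[0, T]%classic (cl r).
  by rewrite /= in_itv/= le_max lexx ge_max (ltW T0) ge_min lexx.
have clid r : 0 <= r <= T -> cl r = r.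
  by move=> /andP[r0 rT]; rewrite /cl (min_idPr rT) (max_idPr r0).
have ccl : continuous cl.
  move=> r; apply: continuous_max; first exact: cvg_cst.
  by apply: continuous_min; [exact: cvg_cst|exact: cvg_id].
pose E := F \o cl.
have cE : continuous E.
  move=> r; have /subspace_continuousP/(_ _ (clin r)) := cF.
  apply: cvg_comp => W; rewrite /within/= => HW.
  have := ccl r _ HW; apply: (@filterS _ (nbhs r)) => y /=.
  by apply; exact: clin.
have PhiE t : t <= T -> Phi t = \int[lebesgue_measure]_(r in `[0, t]) E r.
  move=> tT; apply: eq_Rintegral => r; rewrite inE/= in_itv/= => /andP[r0 rt].
  by rewrite /E/= clid// r0 (le_trans rt).
(* The segment goes past [T], which makes every [s] in []0, T]] an interior point for the
   fundamental theorem of calculus. *)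
have iE : lebesgue_measure.-integrable `[0, T + 1] (EFin \o E).
  apply: continuous_compact_integrable; first exact: segment_compact.
  exact: continuous_subspaceT.
have sT1 : s < T + 1 by lra.
have [dE DE] := continuous_FTC1_closed sT1 iE s0 (cE s).
have Es : E s = F s by rewrite /E /= clid// ltW.
rewrite -Es -DE derive1E.
pose Psi x := \int[lebesgue_measure]_(r in `[0, x]) E r.
have : h^-1 *: ((Psi \o shift s) (h *: 1) - Psi s) @[h --> 0^'-] --> 'D_1 Psi s.
  by apply: cvg_dnbhs_at_left; exact: dE.
(* For [h < 0] both [s] and [h + s] are at most [T], where the primitives of [F] and of its
   extension agree. *)
apply: cvg_trans; apply: near_eq_cvg; near=> h.
have h0 : h < 0 by [].
have hsT : h + s <= T by rewrite (le_trans _ sT)// gerDr ltW.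
by rewrite /= [_%:A]mulr1 !PhiE.
Unshelve. all: by end_near. Qed.

(** * The comparison argument on the closed cylinder *)

(* The derivatives of [u] are arbitrary functions [ut], [p], [q], related to [u]
   by the hypotheses: these are linear in [(u, ut, p, q)], so that the lemma
   also applies to [- u]. *)
Lemma parabolic_comparison (R : realType) (n : nat) (U : set 'rV[R]_n)
    (T t M : R) (A : 'rV[R]_n * R -> 'M[R]_n) (u ut : 'rV[R]_n * R -> R)
    (p : 'I_n -> 'rV[R]_n * R -> R) (q : 'I_n -> 'I_n -> 'rV[R]_n * R -> R)
    (F : R -> R) :
  open U -> bounded_set U -> 0 < t -> t <= T ->
  (forall z, cylinder U T z -> (A z)^T = A z) ->
  (forall z, cylinder U T z -> forall v : 'rV[R]_n, v != 0 ->
     0 < (v *m A z *m v^T) 0 0) ->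
  {within closed_cylinder U T, continuous u} ->
  (forall x s, cylinder U T (x, s) ->
     h^-1 * (u (x, h + s) - u (x, s)) @[h --> 0^'-] --> ut (x, s)) ->
  (forall x s, cylinder U T (x, s) -> forall i,
     is_derive x (delta_mx 0 i) (fun y => u (y, s)) (p i (x, s))) ->
  (forall x s, cylinder U T (x, s) -> forall i,
     {for x, continuous (fun y => p i (y, s))}) ->
  (forall x s, cylinder U T (x, s) -> forall i j,
     is_derive x (delta_mx 0 i) (fun y => p j (y, s)) (q i j (x, s))) ->
  (forall x s, cylinder U T (x, s) -> forall i j,
     {for x, continuous (fun y => q i j (y, s))}) ->
  {within `[0, T], continuous F} ->
  (forall s, 0 <= s <= T -> 0 <= F s) ->
  (forall x s, cylinder U T (x, s) -> (forall i, p i (x, s) = 0) ->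
     ut (x, s) - inner_mx (A (x, s)) (\matrix_(i, j) q i j (x, s)) <= F s) ->
  (forall z, parabolic_boundary U t z -> u z <= M) ->
  forall z, closed_cylinder U t z ->
    u z <= M + \int[lebesgue_measure]_(tau in `[0, t]) F tau.
Proof.
move=> oU bU t0 tT symA posA uC utP up pC pq qC cF F0 LF uM z zt.
have T0 : 0 < T := lt_le_trans t0 tT.
have := primitive_on_segment T0 cF F0.
move=> /[let] Phi [cPhi Phi0 Phimono PhiD].
rewrite -/(Phi t).
apply/ler_addgt0Pr => e e0.
(* With this slope the linear correction [eps * s] never exceeds [e] on [[0, t]]. *)
pose eps := e / t; have eps0 : 0 < eps by exact: divr_gt0.
pose w (y : 'rV[R]_n * R) := u y - (Phi y.2 + eps * y.2).
have sub := @closed_cylinder_sub R n U _ _ tT.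
have wC : {within closed_cylinder U t, continuous w}.
  apply: within_continuousB; first exact: continuous_subspaceW uC.
  apply: within_continuousD.
    apply/subspace_continuousP => -[x s] xs.
    have sT : `[0, T]%classic s by have [] := sub _ xs.
    have /subspace_continuousP/(_ _ sT) := cPhi.
    apply: cvg_comp => W HW.
    have : nbhs (x, s) (snd @^-1` [set r | `[0, T]%classic r -> W r]).
      exact: (@cvg_snd _ _ (nbhs x) (nbhs s) _ _ HW).
    by apply: filterS => y Wy /sub[_ /=]; exact: Wy.
  apply: continuous_subspaceT => y; apply: cvgMr; exact: cvg_snd.
have [[x0 s0] /set_mem z0t wmax] :=
  compact_EVT_max (ex_intro _ z zt) (compact_closed_cylinder bU) wC.
have wz : u z - (Phi z.2 + eps * z.2) <= w (x0, s0) by apply/wmax/mem_set.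
have z2 : 0 <= z.2 <= t by move: zt => [_ /=]; rewrite in_itv.
(* It is enough to bound the maximum of [w] by [M]: undoing the correction at [z] costs at most
   [Phi t + e], as [Phi] is monotone. *)
have wM : w (x0, s0) <= M -> u z <= M + Phi t + e.
  move=> H; have := Phimono z.2 t; case/andP: z2 => z20 z2t /(_ z20 z2t tT) => PP.
  have : eps * z.2 <= eps * t by rewrite ler_pM2l.
  rewrite {2}/eps divfK ?gt_eqF// => ?; lra.
have [_ /=] := z0t; rewrite in_itv/= => /andP[s00 s0t].
(* On the parabolic boundary [w] is at most [u], hence at most [M], because the subtracted terms are
   nonnegative. *)
case: (pselect (cylinder U t (x0, s0))) => [ct|nct]; last first.
  apply: wM; rewrite /w/=; have := uM (x0, s0) (conj z0t nct).
  have := Phi0 s0; rewrite s00 (le_trans s0t tT) => /(_ isT) ? ?.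
  have : 0 <= eps * s0 by rewrite mulr_ge0// ltW.
  lra.
exfalso.
have [/= Ux0] := ct; rewrite in_itv/= => /andP[s0pos _].
have s0T : s0 <= T := le_trans s0t tT.
have cT y : U y -> cylinder U T (y, s0) by move=> Uy; split=> //=; rewrite in_itv/= s0pos.
(* At the fixed time [s0] the subtracted terms are constant in [y], so [u] itself is maximal
   there. *)
have umax y : U y -> u (y, s0) <= u (x0, s0).
  move=> Uy; have := wmax (y, s0); rewrite /w/= lerD2r; apply; apply/mem_set.
  by split; [exact: subset_closure|rewrite /= in_itv/= s00].
have [p0 qneg] := interior_max_second_order oU
   (fun y Uy => up _ _ (cT y Uy)) (fun y Uy => pC _ _ (cT y Uy))
   (fun y Uy => pq _ _ (cT y Uy)) (qC _ _ (cT _ Ux0)) Ux0 umax.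
have trneg : inner_mx (A (x0, s0)) (\matrix_(i, j) q i j (x0, s0)) <= 0.
  rewrite /inner_mx symA; last exact: cT.
  apply: mxtrace_posdef_negsemidef => [||v].
  - by apply: symA; exact: cT.
  - by apply: posA; exact: cT.
  - have -> : (v *m (\matrix_(i, j) q i j (x0, s0)) *m v^T) 0 0 =
        \sum_i v 0 i * \sum_j v 0 j * q j i (x0, s0).
      rewrite mxE; apply: eq_bigr => i _; rewrite !mxE mulrC; congr (_ * _).
      by apply: eq_bigr => j _; rewrite mxE.
    exact: qneg.
have utF : F s0 + eps <= ut (x0, s0).
  have quot : h^-1 * (u (x0, h + s0) - u (x0, s0)) - h^-1 * (Phi (h + s0) - Phi s0)
      @[h --> 0^'-] --> ut (x0, s0) - F s0.
    by apply: cvgB; [apply: utP; exact: cT|apply: PhiD; rewrite s0pos].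
  (* For [h < 0], dividing the maximality inequality at [(x0, h + s0)] by [h] reverses it and bounds
     the quotient of [u - Phi] below by [eps]; the bound passes to the limit. *)
  rewrite addrC -lerBrDr; apply: (cvgr_to_ge quot).
  near=> h.
  have h0 : h < 0 by [].
  have hs : - s0 <= h by near: h; apply: nbhs_left_ge; lra.
  have := wmax (x0, h + s0); rewrite /w/= => /(_ _).
  rewrite -mulrBr => H.
  rewrite -(ler_nM2l h0) mulVKf ?lt_eqF//.
  suff : u (x0, h + s0) - (Phi (h + s0) + eps * (h + s0)) <=
         u (x0, s0) - (Phi s0 + eps * s0) by lra.
  apply: H; apply/mem_set; split; first by have [] := z0t.
  by rewrite /= in_itv/=; apply/andP; split; lra.
have := LF _ _ (cT _ Ux0) p0; lra.
Unshelve. all: by end_near. Qed.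

(** * From derivatives relative to the cylinder to the hypotheses of the comparison *)

(** Small negative increments keep [h + s] in []0, T]], even for [s = T], so the relative limit is
    in particular a limit along them. *)
Lemma deriv_within_left (R : realType) (T s : R) (f : R -> R) :
  0 < s <= T -> derivable_within `]0, T] f s ->
  h^-1 * (f (h + s) - f s) @[h --> 0^'-] --> deriv_within `]0, T] f s.
Proof.
move=> /andP[s0 sT] fs; apply: cvg_trans fs => W HW.
have {}HW : \forall h \near (0 : R)^'-, h != 0 ->
    `]0, T]%classic (h + s) -> W (h^-1 * (f (h + s) - f s)).
  exact: (@cvg_within _ (nbhs (0 : R)) _ _ _ HW).
rewrite /= nbhs_simpl/=; near=> h.
have h0 : h < 0 by [].
have hs : - s < h by near: h; apply: nbhs_left_gt; rewrite oppr_lt0.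
suff : h != 0 -> `]0, T]%classic (h + s) -> W (h^-1 * (f (h + s) - f s)).
  apply; first by rewrite lt_eqF.
  by rewrite /= in_itv/= -ltrBlDr sub0r hs (le_trans _ sT)// gerDr ltW.
by near: h; exact: HW.
Unshelve. all: by end_near. Qed.

(** Openness of [U] turns continuity relative to [U] in the space variable into ordinary continuity
    at [x]. *)
Lemma continuous_slice (R : realType) (n : nat) (U : set 'rV[R]_n) (I : set R)
    (g : 'rV[R]_n * R -> R) (x : 'rV[R]_n) (s : R) :
  open U -> {within U `*` I, continuous g} -> U x -> I s ->
  {for x, continuous (fun y => g (y, s))}.
Proof.
move=> oU gc Ux Is.
have /subspace_continuousP/(_ (x, s) (conj Ux Is)) := gc.
apply: (@cvg_comp _ _ _ (fun y => (y, s)) g (nbhs x)) => W HW.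
have sl : (fun y => (y, s)) @ x --> (x, s).
  exact: (@cvg_pair _ _ _ (nbhs x) (nbhs x) (nbhs s) _ _ _ id (cst s) cvg_id (cvg_cst s)).
have nU : nbhs x U by exact: open_nbhs_nbhs.
have := sl _ HW; apply: (@filterS2 _ (nbhs x) _ _ _ _ _ nU) => y Uy /=.
by apply.
Qed.

Lemma dotv_mulmv (R : realType) n (A : 'M[R]_n) (v : 'rV[R]_n) :
  dotv v (mulmv A v) = (v *m A *m v^T) 0 0.
Proof.
rewrite -mulmxA [RHS]mxE; apply: eq_bigr => i _.
by rewrite /mulmv [in LHS]mxE.
Qed.

Lemma dotv_gt0 (R : realType) n (v : 'rV[R]_n) : v != 0 -> 0 < dotv v v.
Proof.
move=> /rV0Pn[i vi]; rewrite /dotv (bigD1 i)//= ltr_pwDl//.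
  by rewrite -expr2 exprn_even_gt0.
by apply: sumr_ge0 => j _; rewrite -expr2 sqr_ge0.
Qed.

Lemma dotv0 (R : realType) n (v : 'rV[R]_n) : dotv v 0 = 0.
Proof. by rewrite /dotv big1// => i _; rewrite mxE mulr0. Qed.

Theorem theorem3p1 (R : realType) (n : nat) (hn : (1 <= n)%N)
  (U : set 'rV[R]_n) (U0 : U !=set0) (oU : open U) (bU : bounded_set U)
  (J : set R) (itvJ : is_interval J) (J0 : J° !=set0)
  (P : R -> R) (PC1 : C1_on J P)
  (P'_ge0 : forall s, J s -> 0 <= deriv_within J P s)
  (T : R) (T_gt0 : 0 < T)
  (A : 'rV[R]_n * R -> 'M[R]_n)
  (symA : forall z, cylinder U T z -> (A z)^T = A z)
  (K : 'rV[R]_n * R -> 'M[R]_n)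
  (B : 'rV[R]_n * R -> R -> 'rV[R]_n)
  (b : 'rV[R]_n * R -> 'rV[R]_n)
  (ellA : exists2 c0 : R, 0 < c0 &
    forall z, cylinder U T z -> forall xi : 'rV[R]_n,
      c0 * dotv xi xi <= dotv xi (mulmv (A z) xi))
  (u : 'rV[R]_n * R -> R)
  (uC : {within closed_cylinder U T, continuous u})
  (uC21 : C21 U `]0, T] u)
  (L : ('rV[R]_n * R -> R) -> 'rV[R]_n * R -> R)
  (hL : L = Ltilde `]0, T] A b \/
        (L = Lop `]0, T] J A K B P /\ u @` cylinder U T `<=` J)) :
  let G1 := fun t => max_on u (parabolic_boundary U t) in
  let G2 := fun t => min_on u (parabolic_boundary U t) in
  let G := fun t => max_on (fun z => `|u z|) (parabolic_boundary U t) in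
  [/\ forall F1 : R -> R,
        {within `[0, T], continuous F1} ->
        (forall t, 0 <= t <= T -> 0 <= F1 t) ->
        (forall x t, cylinder U T (x, t) -> L u (x, t) <= F1 t) ->
        forall t, 0 < t <= T ->
          max_on u (closed_cylinder U t)
            <= G1 t + \int[lebesgue_measure]_(tau in `[0, t]) F1 tau,
      forall F2 : R -> R,
        {within `[0, T], continuous F2} ->
        (forall t, 0 <= t <= T -> 0 <= F2 t) ->
        (forall x t, cylinder U T (x, t) -> - F2 t <= L u (x, t)) ->
        forall t, 0 < t <= T ->
          G2 t - \int[lebesgue_measure]_(tau in `[0, t]) F2 tau
            <= min_on u (closed_cylinder U t) &
      forall F : R -> R,
        {within `[0, T], continuous F} ->
        (forall t, 0 <= t <= T -> 0 <= F t) ->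
        (forall x t, cylinder U T (x, t) -> `|L u (x, t)| <= F t) ->
        forall t, 0 < t <= T ->
          max_on (fun z => `|u z|) (closed_cylinder U t)
            <= G t + \int[lebesgue_measure]_(tau in `[0, t]) F tau].
Proof.
move=> G1 G2 G.
have posA z : cylinder U T z -> forall v : 'rV[R]_n, v != 0 ->
    0 < (v *m A z *m v^T) 0 0.
  have [c0 c00 H] := ellA => zT v v0; rewrite -dotv_mulmv.
  by rewrite (lt_le_trans _ (H z zT v))// mulr_gt0// dotv_gt0.
have [_ [ud _] udx udxx] := uC21.
have Lu z : (forall i, dx i u z = 0) ->
    L u z = dt `]0, T] u z - inner_mx (A z) (hess u z).
  move=> u0; have g0 : grad u z = 0 by apply/rowP => i; rewrite !mxE.
  by case: hL => [->|[-> _]]; rewrite /Ltilde /Lop g0 !dotv0 ?mulr0 !addr0.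
(* The factor [c] will be 1 or -1, giving upper and lower bounds from one argument. As [c] is
   nonzero, the gradient of [c * u] vanishes only where that of [u] does, and there [L u] is the
   reduced operator. *)
have scaled (c M t : R) (F : R -> R) : c != 0 -> 0 < t <= T ->
    {within `[0, T], continuous F} ->
    (forall s, 0 <= s <= T -> 0 <= F s) ->
    (forall x s, cylinder U T (x, s) -> c * L u (x, s) <= F s) ->
    (forall z, parabolic_boundary U t z -> c * u z <= M) ->
    forall z, closed_cylinder U t z ->
      c * u z <= M + \int[lebesgue_measure]_(tau in `[0, t]) F tau.
  move=> c0 /andP[t0 tT] cF F0 LF uM.
  apply: (@parabolic_comparison R n U T t M A (fun z => c * u z)
    (fun z => c * dt `]0, T] u z) (fun i z => c * dx i u z)
    (fun i j z => c * dx i (dx j u) z) F) => //.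
  - by move=> z; apply: cvgMr; exact: uC.
  - move=> x s xs; have s0T : 0 < s <= T by have [_ /=] := xs; rewrite in_itv.
    have -> : (fun h => h^-1 * (c * u (x, h + s) - c * u (x, s))) =
        c \*: (fun h => h^-1 * (u (x, h + s) - u (x, s))).
      by apply/funext => h /=; rewrite -[_ *: _]/(_ * _) -mulrBr mulrCA.
    exact: cvgZl_tmp (deriv_within_left s0T (ud _ xs)).
  - move=> x s xs i; apply: is_deriveZ.
    exact: (derivableP ((udx i).1 (x, s) xs)).
  - move=> x s [Ux Is] i.
    exact: (cvgMr (continuous_slice oU (udx i).2 Ux Is)).
  - move=> x s xs i j; apply: is_deriveZ.
    exact: (derivableP ((udxx i j).1 (x, s) xs)).
  - move=> x s [Ux Is] i j.
    exact: cvgMr (continuous_slice oU (udxx i j).2 Ux Is).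
  - move=> x s xs p0; have := LF _ _ xs; rewrite Lu ?mulrBr; last first.
      by move=> i; have /eqP := p0 i; rewrite mulf_eq0 (negbTE c0) => /eqP.
    suff <- : inner_mx (A (x, s)) (\matrix_(i, j) (c * dx i (dx j u) (x, s))) =
        c * inner_mx (A (x, s)) (hess u (x, s)) by [].
    rewrite /inner_mx -mxtraceZ scalemxAr; congr (\tr (_ *m _)).
    by apply/matrixP => i j; rewrite !mxE.
have sub t : t <= T -> parabolic_boundary U t `<=` closed_cylinder U T.
  by move=> tT z [zt _]; exact: closed_cylinder_sub zt.
have contD (f : 'rV[R]_n * R -> R) t :
    {within closed_cylinder U T, continuous f} -> t <= T ->
    {within closed_cylinder U t, continuous f} /\
    {within parabolic_boundary U t, continuous f}.
  move=> fC tT; split; apply: continuous_subspaceW fC; last exact: sub.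
  exact: closed_cylinder_sub.
have maxD (f : 'rV[R]_n * R -> R) t :
    {within closed_cylinder U T, continuous f} -> 0 < t <= T ->
    is_max f (closed_cylinder U t) (max_on f (closed_cylinder U t)) /\
    is_max f (parabolic_boundary U t) (max_on f (parabolic_boundary U t)).
  move=> fC /andP[t0 tT]; have [cf pf] := contD f t fC tT.
  have [y yt] := parabolic_boundary_neq0 (ltW t0) U0.
  split; apply: max_onP => //; [by exists y; case: yt|
    exact: compact_closed_cylinder|by exists y|
    exact: compact_parabolic_boundary].
split=> F cF F0 LF t t0T.
- have [[[z zt <-] _] [_ uG]] := maxD u t uC t0T.
  rewrite -[u z]mul1r; apply: (scaled 1) => //.
  + by move=> x s xs; rewrite mul1r LF.
  + by move=> y yt; rewrite mul1r uG.
- have /andP[t0 tT] := t0T; have [cu pu] := contD u t uC tT.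
  have [y yt] := parabolic_boundary_neq0 (ltW t0) U0.
  have [|||[z zt <-] _] := min_onP (f := u) (D := closed_cylinder U t).
  + by exists y; case: yt.
  + exact: compact_closed_cylinder.
  + exact: cu.
  have [|||_ uG] := min_onP (f := u) (D := parabolic_boundary U t).
  + by exists y.
  + exact: compact_parabolic_boundary.
  + exact: pu.
  (* The lower bound for [u] is the upper bound for [- u], with boundary bound [- G2 t]. *)
  rewrite -lerN2 opprB addrC -mulN1r; apply: (scaled (-1)) => //.
  + by move=> x s xs; rewrite mulN1r lerNl LF.
  + by move=> x xt; rewrite mulN1r lerN2 uG.
- have nuC : {within closed_cylinder U T, continuous (fun z => `|u z|)}.
    by move=> z; apply: cvg_norm; exact: uC.
  have [[[z zt <-] _] [_ uG]] := maxD _ t nuC t0T.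
  (* Both [- u] and [u] are at most [G t] on the parabolic boundary, and both signs of [L u] are
     controlled by [F]. *)
  rewrite ler_norml lerNl; apply/andP; split.
  + rewrite -mulN1r; apply: (scaled (-1)) => //.
    * move=> x s xs; rewrite mulN1r (le_trans _ (LF _ _ xs))//.
      by rewrite -normrN ler_norm.
    * move=> y yt; rewrite mulN1r (le_trans _ (uG _ yt))//.
      by rewrite -normrN ler_norm.
  + rewrite -[u z]mul1r; apply: (scaled 1) => //.
    * by move=> x s xs; rewrite mul1r (le_trans (ler_norm _) (LF _ _ xs)).
    * by move=> y yt; rewrite mul1r (le_trans (ler_norm _) (uG _ yt)).
Qed.
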